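(* Let $G$ be a finite group. Let $\mathcal X$ and $\mathcal Y$ be partitions of $\mathrm{Irr}(G)$ and let $\mathcal K$ and $\mathcal L$ be partitions of $G$ such that $(\mathcal X,\mathcal K)$ and $(\mathcal Y,\mathcal L)$ are both supercharacter theories of $G$. Then $(\mathcal X\vee\mathcal Y,\ \mathcal K\vee\mathcal L)$ is also a supercharacter theory of $G$.
   Context: $\mathrm{Irr}(G)$ is the set of complex irreducible characters of $G$. A supercharacter theory of $G$ is a pair $(\mathcal X,\mathcal K)$, with $\mathcal X$ a partition of $\mathrm{Irr}(G)$ and $\mathcal K$ a partition of $G$, such that $|\mathcal X|=|\mathcal K|$ and for every $X\in\mathcal X$ there is a character $\chi_X$ of $G$ whose irreducible constituents lie in $X$, with each $\chi_X$ constant on every part $K\in\mathcal K$, and every irreducible character of $G$ a constituent of some $\chi_X$. (It is known, by Diaconis and Isaacs, that $\chi_X$ is then a constant multiple of $\sigma_X=\sum_{\psi\in X}\psi(1)\psi$, and one always takes $\chi_X=\sigma_X$.) The partitions of a finite set are partially ordered by $\mathcal P\preceq\mathcal Q$ iff every part of $\mathcal P$ is contained in a part of $\mathcal Q$; this is a lattice, and $\vee$ denotes its join (least upper bound, i.e. the finest partition coarser than both). *)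

(* Defs.v *)
From mathcomp Require Import all_boot all_order all_algebra all_fingroup.
From mathcomp Require Import all_solvable all_field all_character.

Set Implicit Arguments.
Unset Strict Implicit.
Unset Printing Implicit Defensive.

Section PartitionLattice.

Variable T : finType.
Implicit Types (D : {set T}) (P Q J R : {set {set T}}).

Definition refines P Q := [forall A in P, [exists B in Q, A \subset B]].

Definition is_partition_join D P Q J :=
  [&& partition J D, refines P J, refines Q J &
      [forall R, [&& partition R D, refines P R & refines Q R] ==>
                 refines J R]].

(* The default value set0 is never used when P and Q are partitions of D: see *)
(* partition_joinP and is_partition_join_unique.                              *)
Definition partition_join D P Q : {set {set T}} :=
  odflt set0 [pick J | is_partition_join D P Q J].

Lemma refinesP D P Q : partition P D -> partition Q D ->
  reflect {in D, forall x, pblock P x \subset pblock Q x} (refines P Q).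
Proof.
move=> pP pQ; have tP := partition_trivIset pP; have tQ := partition_trivIset pQ.
have cP := cover_partition pP; have cQ := cover_partition pQ.
apply: (iffP forall_inP) => [rPQ x xD | sPQ A AP].
  have xP : x \in cover P by rewrite cP.
  have /exists_inP[B BQ sB] := rPQ _ (pblock_mem xP).
  have xB : x \in B by rewrite (subsetP sB) // mem_pblock.
  by rewrite (def_pblock tQ BQ xB).
have /set0Pn[x xA] := partition_neq0 pP AP.
have xD := subsetP (partitionS pP AP) x xA.
apply/exists_inP; exists (pblock Q x); first by rewrite pblock_mem ?cQ.
by rewrite -(def_pblock tP AP xA) sPQ.
Qed.

Lemma refines_anti D P Q : partition P D -> partition Q D ->
  refines P Q -> refines Q P -> P = Q.
Proof.
move=> pP pQ /(refinesP pP pQ) sPQ /(refinesP pQ pP) sQP.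
rewrite -(equivalence_partition_pblock pP) -(equivalence_partition_pblock pQ).
apply: eq_in_imset => x xD; apply/setP=> y; rewrite !inE; congr (_ && _).
by apply/idP/idP; apply/subsetP; [apply: sPQ | apply: sQP].
Qed.

Lemma is_partition_join_unique D P Q J J' :
  is_partition_join D P Q J -> is_partition_join D P Q J' -> J = J'.
Proof.
move=> /and4P[pJ PJ QJ /forallP lJ] /and4P[pJ' PJ' QJ' /forallP lJ'].
apply: (refines_anti pJ pJ').
  by apply: (implyP (lJ J')); apply/and3P.
by apply: (implyP (lJ' J)); apply/and3P.
Qed.

Lemma partition_joinP D P Q : partition P D -> partition Q D ->
  is_partition_join D P Q (partition_join D P Q).
Proof.
move=> pP pQ; rewrite /partition_join; case: pickP => //= noJ.
pose e x y := (y \in pblock P x) || (y \in pblock Q x).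
have sbl R x y : partition R D -> y \in pblock R x -> x \in pblock R y.
  move=> pR xy; have tR := partition_trivIset pR.
  rewrite (same_pblock tR xy) mem_pblock.
  case: (boolP (x \in cover R)) => // nx; move: xy.
  rewrite /pblock; case: pickP => [A /andP[AR xA] _|_]; last by rewrite inE.
  by case/bigcupP: nx; exists A.
have esym : symmetric e.
  by move=> x y; apply/orP/orP=> -[] /sbl; [left|right|left|right]; auto.
have eqv : {in D & &, equivalence_rel (connect e)}.
  move=> x y z _ _ _; split=> // xy.
  exact: (same_connect (sym_connect_sym esym)).
have pJ := equivalence_partitionP eqv.
have bJ := pblock_equivalence_partition eqv.
set J := equivalence_partition _ _ in pJ bJ.
have inD R x y : partition R D -> y \in pblock R x -> y \in D.
  move=> pR /(sbl _ _ _ pR); rewrite -(cover_partition pR) -mem_pblock => xy.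
  by rewrite (same_pblock (partition_trivIset pR) (sbl _ _ _ pR xy)) sbl.
have := noJ J; rewrite /is_partition_join pJ /= => /negP[]; apply/and3P; split.
- apply/(refinesP pP pJ) => x xD; apply/subsetP=> y xy.
  by rewrite bJ ?(inD _ _ _ pP xy) // connect1 // /e xy.
- apply/(refinesP pQ pJ) => x xD; apply/subsetP=> y xy.
  by rewrite bJ ?(inD _ _ _ pQ xy) // connect1 // /e xy orbT.
apply/forallP=> R; apply/implyP=> /and3P[pR].
move=> /(refinesP pP pR) sPR /(refinesP pQ pR) sQR.
apply/(refinesP pJ pR) => x xD; apply/subsetP=> y xy; move: (inD _ _ _ pJ xy) => yD.
move: xy; rewrite bJ // => /connectP[p]; elim: p x xD => [|z p IHp] x xD /=.
  by move=> _ ->; rewrite mem_pblock (cover_partition pR).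
case/andP=> xz zp ly; have xzR : z \in pblock R x.
  by case/orP: xz; apply/subsetP; [apply: sPR | apply: sQR].
rewrite -(same_pblock (partition_trivIset pR) xzR).
exact: IHp (inD _ _ _ pR xzR) zp ly.
Qed.

End PartitionLattice.

(* Irr(G) is indexed by Iirr G, so a partition of Irr(G) is a partition of    *)
(* [set: Iirr G]. The zero class function satisfies \is a character, but the  *)
(* last clause, together with the disjointness of the parts, rules it out as  *)
(* a value of chi on a part.                                                  *)
Definition supercharacter_theory (gT : finGroupType) (G : {group gT})
    (X : {set {set Iirr G}}) (K : {set {set gT}}) : Prop :=
  [/\ partition X [set: Iirr G], partition K G, #|X| = #|K| &
   exists chi : {set Iirr G} -> 'CF(G),
     [/\ forall A, A \in X -> chi A \is a character,
         forall A, A \in X -> {subset irr_constt (chi A) <= A},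
         forall A B, A \in X -> B \in K ->
           {in B &, forall x y, chi A x = chi A y}
       & forall i : Iirr G, exists2 A, A \in X & i \in irr_constt (chi A)]].

Arguments supercharacter_theory {gT} G X K.

(* Main.v *)
(* Let Phi send a function a on Irr(G) to the class function                  *)
(* sum_i a(i) chi_i(1) chi_i; it is linear and injective. For partitions X of *)
(* Irr(G) and K of G, (X, K) is a supercharacter theory iff Phi maps the      *)
(* functions constant on the parts of X onto those constant on the parts of   *)
(* K. The functions constant on the parts of a join are those constant on the *)
(* parts of both partitions, and the injective map Phi preserves such         *)
(* intersections.                                                             *)
Require Import Defs.
From HB Require Import structures.
From mathcomp Require Import all_boot all_order all_algebra all_fingroup.
From mathcomp Require Import all_solvable all_field all_character.

Set Implicit Arguments.
Unset Strict Implicit.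
Unset Printing Implicit Defensive.

Import GRing.Theory Num.Theory.
Local Open Scope ring_scope.

(** Phi is [weighted_irr_fun] with the degrees as weights, and [block_space] is the space of
    functions constant on the parts of a partition. As Phi is injective and [#|X| = #|K|] is the
    equality of two dimensions, mapping [block_space algC X] into [block_space algC K] already means
    mapping it onto ([limg_weighted_irr_dim]). The criterion by images is
    [supercharacter_theory_limg] in one direction and [limg_supercharacter_theory] in the other; the
    former has to pass from the given characters to the sums of chi_i(1) chi_i. Joins turn into
    intersections by [block_space_join]. *)

Section BlockConstantFunctions.

Variables (F : fieldType) (T : finType).
Implicit Types (D A : {set T}) (P Q : {set {set T}}) (f : {ffun T -> F^o}).

Definition set_indicator A : {ffun T -> F^o} := [ffun x => (x \in A)%:R].

(** Members vanish off the union of P. For a partition of G this agrees with class functions, which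
    are 0 outside G. *)
Definition block_space P : {vspace {ffun T -> F^o}} :=
  <<[seq set_indicator A | A <- enum P]>>%VS.

Lemma sum_set_indicatorE D P (c : {set T} -> F) x : partition P D ->
  (\sum_(A in P) c A *: set_indicator A) x =
    if x \in D then c (pblock P x) else 0.
Proof.
move=> pP; have tP := partition_trivIset pP; have cP := cover_partition pP.
rewrite sum_ffunE; case: ifP => xD.
  have bP : pblock P x \in P by rewrite pblock_mem ?cP.
  rewrite (bigD1 _ bP) /= big1 ?addr0 => [|A /andP[AP neA]].
    by rewrite !ffunE mem_pblock cP xD /GRing.scale /= mulr1.
  rewrite !ffunE; case: (boolP (x \in A)) => xA; last by rewrite scaler0.
  by rewrite (def_pblock tP AP xA) eqxx in neA.
rewrite big1 // => A AP; rewrite !ffunE.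
case: (boolP (x \in A)) => xA; last by rewrite scaler0.
by rewrite (subsetP (partitionS pP AP)) in xD.
Qed.

Lemma mem_block_space D P f : partition P D ->
  reflect ((forall A, A \in P -> {in A &, forall x y, f x = f y})
           /\ (forall x, x \notin D -> f x = 0))
          (f \in block_space P).
Proof.
move=> pP; have tP := partition_trivIset pP; have cP := cover_partition pP.
apply: (iffP idP) => [/(@coord_span _ _ _ (in_tuple _)) -> | [fP fD]].
  set s := [seq _ | _ <- _]; have sE (i : 'I_(size s)) :
      exists2 A, A \in P & s`_i = set_indicator A.
    have /mapP[A] := mem_nth 0 (ltn_ord i).
    by rewrite mem_enum => AP ->; exists A.
  split=> [A AP x y xA yA | x xD]; rewrite !sum_ffunE.
    apply: eq_bigr => i _; have [B BP ->] := sE i; rewrite !ffunE.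
    have [->|neBA] := eqVneq B A; first by rewrite xA yA.
    have dBA := trivIsetP tP _ _ BP AP neBA.
    by rewrite (disjointFl dBA xA) (disjointFl dBA yA).
  apply: big1 => i _; have [B BP ->] := sE i; rewrite !ffunE.
  by rewrite (contraNF (subsetP (partitionS pP BP) x)) // scaler0.
(* The common value of f on A; the default 0 is never reached, parts being nonempty. *)
pose c A := if [pick x in A] is Some x then f x else 0.
suff -> : f = \sum_(A in P) c A *: set_indicator A.
  apply: rpred_sum => A AP; apply: rpredZ; apply: memv_span.
  by apply: map_f; rewrite mem_enum.
apply/ffunP=> x; rewrite (sum_set_indicatorE _ _ pP).
case: ifPn => [xD|]; last exact: fD.
have xb : x \in pblock P x by rewrite mem_pblock cP.
rewrite /c; case: pickP => [y yb|/(_ x)]; last by rewrite xb.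
by apply: (fP (pblock P x)); rewrite ?pblock_mem ?cP.
Qed.

Lemma dim_block_space D P : partition P D -> \dim (block_space P) = #|P|.
Proof.
move=> pP; rewrite cardE -(size_map set_indicator); apply/eqP.
(* [free] is by definition the equality of the dimension of the span with the length of the
   sequence. *)
rewrite -[_ == _]/(free _).
pose s := [seq set_indicator A | A <- enum P].
rewrite -/s -[s]in_tupleE; apply/freeP => k /= Dk i.
have lt_i : (i < size (enum P))%N by rewrite -(size_map set_indicator).
pose A := nth set0 (enum P) i.
have AP : A \in P by rewrite -mem_enum mem_nth.
have /set0Pn[x xA] := partition_neq0 pP AP.
(* At a point x of the i-th part all other indicators vanish, which isolates [k i]. *)
move/ffunP/(_ x): Dk; rewrite sum_ffunE (bigD1 i) //= big1 => [|j neij].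
  rewrite !ffunE (nth_map set0) // ffunE xA addr0.
  by rewrite /GRing.scale /= mulr1.
have lt_j : (j < size (enum P))%N by rewrite -(size_map set_indicator).
rewrite !ffunE (nth_map set0) // ffunE.
rewrite (disjointFr _ xA) ?scaler0 //.
apply: (trivIsetP (partition_trivIset pP)) => //.
  by rewrite -mem_enum mem_nth.
by rewrite /A nth_uniq ?enum_uniq // eq_sym.
Qed.

(** If f is constant on the parts of P and of Q, its level sets in D form a partition coarser than
    both, hence coarser than the join. *)
Lemma block_space_join D P Q : partition P D -> partition Q D ->
  block_space (partition_join D P Q) = (block_space P :&: block_space Q)%VS.
Proof.
move=> pP pQ; have /and4P[pJ rPJ rQJ /forallP minJ] := partition_joinP pP pQ.
have coarser R f : partition R D -> refines R (partition_join D P Q) ->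
    f \in block_space (partition_join D P Q) -> f \in block_space R.
  move=> pR /forall_inP rRJ /(mem_block_space _ pJ)[fJ fD].
  apply/(mem_block_space _ pR); split=> // A /rRJ/exists_inP[B BJ /subsetP sAB].
  by move=> x y xA yA; apply: (fJ B) => //; apply: sAB.
apply/vspaceP=> f; rewrite memv_cap; apply/idP/andP=> [fJ | [fP fQ]].
  by split; apply: coarser fJ.
have [fPc fD] := mem_block_space _ pP fP; have [fQc _] := mem_block_space _ pQ fQ.
have pR := preim_partitionP f D.
have refR S : partition S D ->
    (forall A, A \in S -> {in A &, forall x y, f x = f y}) ->
    refines S (preim_partition f D).
  move=> pS fS; apply/forall_inP=> A AS.
  have /set0Pn[x xA] := partition_neq0 pS AS.
  have sAD := subsetP (partitionS pS AS).
  apply/exists_inP; exists [set y in D | f x == f y].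
    by apply/imsetP; exists x; rewrite ?sAD.
  by apply/subsetP=> y yA; rewrite inE sAD //=; apply/eqP; exact: (fS A).
have /forall_inP rJ : refines (partition_join D P Q) (preim_partition f D).
  by apply: (implyP (minJ _)); rewrite pR !refR.
apply/(mem_block_space _ pJ); split=> // A /rJ/exists_inP[B].
case/imsetP=> z _ -> /subsetP sA x y /sA + /sA.
by rewrite !inE => /andP[_ /eqP <-] /andP[_ /eqP <-].
Qed.

End BlockConstantFunctions.

Section WeightedCharacterSums.

Variables (gT : finGroupType) (G : {group gT}).
Implicit Types (m : Iirr G -> algC) (a : {ffun Iirr G -> algC^o}).
Implicit Types (X : {set {set Iirr G}}) (K : {set {set gT}}).

(** The weights stay free because two choices occur: the degrees, and the multiplicities in the
    given characters. *)
Definition weighted_irr m a : 'CF(G) := \sum_i (a i * m i) *: 'chi_i.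

Definition weighted_irr_fun m a : {ffun gT -> algC^o} :=
  [ffun x => weighted_irr m a x].

Lemma weighted_irr_fun_linear m : linear (weighted_irr_fun m).
Proof.
move=> c a b; apply/ffunP=> x; rewrite !ffunE !sum_cfunE.
rewrite scaler_sumr -big_split; apply: eq_bigr => i _ /=.
by rewrite !ffunE !cfunE /GRing.scale /= !mulrDl !mulrA.
Qed.

HB.instance Definition _ m :=
  GRing.isLinear.Build algC {ffun Iirr G -> algC^o} {ffun gT -> algC^o} _
    (weighted_irr_fun m) (weighted_irr_fun_linear m).

Lemma cfdot_weighted_irr m a i : '[weighted_irr m a, 'chi_i] = a i * m i.
Proof.
rewrite cfdot_suml (bigD1 i) //= cfdotZl cfnorm_irr mulr1 big1 ?addr0 //.
by move=> j neji; rewrite cfdotZl cfdot_irr (negbTE neji) mulr0.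
Qed.

(** Inner products with ['chi_i] recover [a i * m i], hence [a i]. *)
Lemma lker_weighted_irr_fun m : (forall i, m i != 0) ->
  lker (linfun (weighted_irr_fun m)) == 0%VS.
Proof.
move=> nz_m; apply/lker0P=> a b; rewrite !lfunE /= => eq_ab.
apply/ffunP=> i; apply: (mulIf (nz_m i)).
rewrite -!cfdot_weighted_irr; congr '[_, _]; apply/cfunP=> x.
by move/ffunP/(_ x): eq_ab; rewrite !ffunE.
Qed.

Lemma limg_weighted_irr_dim m X K : (forall i, m i != 0) ->
    partition X [set: Iirr G] -> partition K G -> #|X| = #|K| ->
    (linfun (weighted_irr_fun m) @: block_space algC X
       <= block_space algC K)%VS ->
  (linfun (weighted_irr_fun m) @: block_space algC X)%VS = block_space algC K.
Proof.
move=> nz_m pX pK eqXK sXK; apply/eqP; rewrite eqEdim sXK /=.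
rewrite limg_dim_eq ?(dim_block_space _ pX) ?(dim_block_space _ pK) ?eqXK //.
by have /eqP-> := lker_weighted_irr_fun nz_m; rewrite capv0.
Qed.

(** With multiplicities as weights, the indicator of A goes to [chi A], so the equality holds for
    these weights by dimension. The regular character then has a preimage b constant on the parts of
    X, and multiplying by b exchanges multiplicities for degrees. *)
Lemma supercharacter_theory_limg X K : supercharacter_theory G X K ->
  (linfun (weighted_irr_fun (fun i => 'chi_i 1%g)) @: block_space algC X)%VS
    = block_space algC K.
Proof.
case=> pX pK eqXK [chi [chiC chiX chiK chiI]].
have tX := partition_trivIset pX.
(* The multiplicity of chi_i in the only [chi A] that can contain it. *)
pose m i := '[chi (pblock X i), 'chi_i].
have nz_m i : m i != 0.
  have [A AX iA] := chiI i.
  by rewrite -irr_consttE (def_pblock tX AX (chiX A AX i iA)).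
have chi_coef A i : A \in X -> '[chi A, 'chi_i] = (i \in A)%:R * m i.
  move=> AX; case: (boolP (i \in A)) => iA.
    by rewrite mul1r /m (def_pblock tX AX iA).
  rewrite mul0r; apply/eqP; rewrite -[_ == 0]negbK -irr_consttE.
  exact: contra (chiX A AX i) iA.
have limg_m : (linfun (weighted_irr_fun m) @: block_space algC X)%VS
              = block_space algC K.
  apply: limg_weighted_irr_dim => //.
  rewrite limg_span; apply/span_subvP=> _ /mapP[_ /mapP[A + ->] ->].
  rewrite mem_enum lfunE => AX /=.
  have -> : weighted_irr_fun m (set_indicator algC A) = [ffun x => chi A x].
    apply/ffunP=> x; rewrite !ffunE; congr (fun_of_cfun _ x).
    rewrite [chi A]cfun_sum_cfdot; apply: eq_bigr => i _.
    by rewrite chi_coef // ffunE.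
  apply/(mem_block_space _ pK); split=> [B BK x y xB yB | x xG].
    by rewrite !ffunE (chiK A B AX BK x y).
  by rewrite ffunE cfun0.
(* The sum of all the [chi A] is faithful, so the part of 1 in K is trivial. *)
have K1 B x : B \in K -> 1%g \in B -> x \in B -> x = 1%g.
  move=> BK B1 xB; have xG := subsetP (partitionS pK BK) x xB.
  have theta_char : \sum_(A in X) chi A \is a character by apply: rpred_sum.
  apply/set1P; rewrite -set1gE -(TI_cfker_irr G); apply/bigcapP=> i _.
  apply: (subsetP (cfker_constt theta_char _)).
    have bX : pblock X i \in X by rewrite pblock_mem ?(cover_partition pX) ?inE.
    rewrite irr_consttE cfdot_suml (bigD1 _ bX) /= big1 => [|A].
      by rewrite addr0 nz_m.
    case/andP=> AX neA; rewrite chi_coef //; case: (boolP (i \in A)) => iA.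
      by rewrite (def_pblock tX AX iA) eqxx in neA.
    by rewrite mul0r.
  rewrite cfkerEchar // inE xG !sum_cfunE; apply/eqP/eq_bigr => A AX.
  exact: (chiK A B).
have regK : [ffun x => cfReg G x : algC^o] \in block_space algC K.
  apply/(mem_block_space _ pK); split=> [B BK x y xB yB | x xG].
    rewrite !ffunE !cfRegE; congr (_ *+ nat_of_bool _).
    apply/eqP/eqP=> eq1; rewrite eq1 in xB yB.
      exact: K1 BK xB yB.
    exact: K1 BK yB xB.
  by rewrite ffunE cfun0.
(* As the regular character lies in the span of the [chi A], each [chi A] is a *)
(* nonzero multiple of the sum of the chi_i(1) chi_i over i in A.             *)
rewrite -limg_m in regK; have [b bX] := memv_imgP regK.
rewrite lfunE /= => Db.
have {Db} bE i : b i * m i = 'chi_i 1%g.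
  rewrite -cfdot_weighted_irr; have -> : weighted_irr m b = cfReg G.
    by apply/cfunP=> x; move/ffunP/(_ x): Db; rewrite !ffunE.
  rewrite cfReg_sum cfdot_suml (bigD1 i) //= cfdotZl cfnorm_irr mulr1.
  by rewrite big1 ?addr0 // => j ji; rewrite cfdotZl cfdot_irr (negbTE ji) mulr0.
(* One inclusion suffices: the image of a under the degree weights is that of a b under m, and a b
   is again constant on the parts of X. *)
apply: (limg_weighted_irr_dim (@irr1_neq0 _ G)) => //.
rewrite -limg_m; apply/subvP=> _ /memv_imgP[a aX ->].
have -> : linfun (weighted_irr_fun (fun i => 'chi[G]_i 1%g)) a
    = linfun (weighted_irr_fun m) [ffun i => a i * b i].
  rewrite !lfunE; apply/ffunP=> x; rewrite !ffunE; congr (fun_of_cfun _ x).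
  by apply: eq_bigr => i _; rewrite ffunE -bE mulrA.
apply: memv_img; have [aP _] := mem_block_space _ pX aX.
have [bP _] := mem_block_space _ pX bX.
apply/(mem_block_space _ pX); split=> [A AX i j iA jA | i]; last by rewrite inE.
by rewrite !ffunE (aP A AX i j) ?(bP A AX i j).
Qed.

(** The image of the indicator of A is the sum of chi_i(1) chi_i over i in A, so this character is
    constant on the parts of K; injectivity gives [#|X| = #|K|]. *)
Lemma limg_supercharacter_theory X K :
    partition X [set: Iirr G] -> partition K G ->
    (linfun (weighted_irr_fun (fun i => 'chi_i 1%g)) @: block_space algC X)%VS
      = block_space algC K ->
  supercharacter_theory G X K.
Proof.
move=> pX pK limgXK.
have cfdot_sigma (A : {set Iirr G}) i :
    '[weighted_irr (fun i => 'chi_i 1%g) (set_indicator algC A), 'chi_i]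
      = (i \in A)%:R * 'chi_i 1%g.
  by rewrite cfdot_weighted_irr ffunE.
split=> //.
  rewrite -(dim_block_space algC pX) -(dim_block_space algC pK) -limgXK.
  rewrite limg_dim_eq //; have /eqP-> := lker_weighted_irr_fun (@irr1_neq0 _ G).
  exact: capv0.
exists (fun A => weighted_irr (fun i => 'chi_i 1%g) (set_indicator algC A)).
split=> [A _ | A _ i | A B AX BK x y xB yB | i].
- apply: rpred_sum => i _; rewrite ffunE.
  case: (i \in A); last by rewrite mul0r scale0r rpred0.
  by have /natrP[n ->] := Cnat_irr1 i; rewrite mul1r scaler_nat rpredMn ?irr_char.
- rewrite irr_consttE cfdot_sigma; case: (i \in A) => //.
  by rewrite mul0r eqxx.
- have : weighted_irr_fun (fun i => 'chi[G]_i 1%g) (set_indicator algC A)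
           \in block_space algC K.
    rewrite -limgXK -lfunE memv_img // memv_span // map_f //.
    by rewrite mem_enum.
  by case/(mem_block_space _ pK)=> /(_ B BK x y xB yB) + _; rewrite !ffunE.
exists (pblock X i); first by rewrite pblock_mem ?(cover_partition pX) ?inE.
rewrite irr_consttE cfdot_sigma mem_pblock (cover_partition pX) inE mul1r.
exact: irr1_neq0.
Qed.

End WeightedCharacterSums.

Theorem proposition4p4 (gT : finGroupType) (G : {group gT})
    (X Y : {set {set Iirr G}}) (K L : {set {set gT}}) :
  supercharacter_theory G X K -> supercharacter_theory G Y L ->
  supercharacter_theory G (partition_join [set: Iirr G] X Y)
                          (partition_join G K L).
Proof.
move=> scXK scYL; have [pX pK _ _] := scXK; have [pY pL _ _] := scYL.
have /and4P[pXY _ _ _] := partition_joinP pX pY.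
have /and4P[pKL _ _ _] := partition_joinP pK pL.
apply: limg_supercharacter_theory => //.
(* The image of an intersection is the intersection of the images only because Phi is injective, the
   degrees being nonzero. *)
rewrite !block_space_join // lker0_img_cap; last first.
  exact/lker_weighted_irr_fun/irr1_neq0.
by rewrite (supercharacter_theory_limg scXK) (supercharacter_theory_limg scYL).
Qed.
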